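(* Let $p_1,\dots,p_s$ be distinct primes and let $m_1,\dots,m_s\ge 1$ be integers. Let $M_j$ be the set of partitions with at most $m_j$ parts, and let $M=\prod_{j=1}^sM_j$. For $\mu\in M$ write $\mu^j$ for its $j$th entry, a partition consisting of non-negative integers $\mu^j_1\ge\mu^j_2\ge\dots\ge\mu^j_{m_j}$. Suppose we have non-negative reals $x_\mu,y_\mu$ for each $\mu\in M$. Suppose further that we have non-negative reals $C_\lambda$ for each $\lambda\in M$ such that $$C_\lambda\le\prod_{j=1}^sF^{m_j}p_j^{\sum_i\frac{\lambda^j_i(\lambda^j_i-1)}{2}},$$ where $F>0$ is an absolute constant (independent of $\lambda$). Suppose that for all $\lambda\in M$, $$\sum_{\mu\in M}x_\mu\prod_{j=1}^sp_j^{\sum_i\lambda^j_i\mu^j_i}=\sum_{\mu\in M}y_\mu\prod_{j=1}^sp_j^{\sum_i\lambda^j_i\mu^j_i}=C_\lambda.$$ Then $x_\mu=y_\mu$ for all $\mu\in M$.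
   Context: A partition with at most $m$ parts is a weakly decreasing sequence of $m$ non-negative integers. In the sums, $i$ ranges over $1\le i\le m_j$. All the infinite sums are of non-negative terms. *)

(* Defs.v *)
From HB Require Import structures.
From mathcomp Require Import all_boot.

Set Implicit Arguments.
Unset Strict Implicit.
Unset Printing Implicit Defensive.

(* Partitions with at most m parts, padded with zeros to length exactly m. *)
Record partition_le (m : nat) := PartitionLe {
  parts :> m.-tuple nat;
  _ : sorted geq parts
}.

HB.instance Definition _ (m : nat) := [isSub for @parts m].
HB.instance Definition _ (m : nat) := [Countable of partition_le m by <:].

Definition multipartition (s : nat) (m : 'I_s -> nat) : choiceType :=
  {dffun forall j : 'I_s, partition_le (m j)}.

(* Indices are 0-based: mpart mu i is the part mu^j_{i+1}, where j is inferred
   from the type 'I_(m j) of i. *)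
Definition mpart (s : nat) (m : 'I_s -> nat) (mu : multipartition m)
    (j : 'I_s) (i : 'I_(m j)) : nat := tnth (mu j) i.

(* Main.v *)
Require Import Defs.
From HB Require Import structures.
From mathcomp Require Import all_boot all_order all_algebra.
From mathcomp Require Import all_classical all_reals all_analysis.
From mathcomp Require Import ring lra zify.

Import Order.TTheory GRing.Theory Num.Theory.
Local Open Scope classical_set_scope.
Local Open Scope ring_scope.

(* Write z_{j,k} = p_j^(mu^j_0 + ... + mu^j_k).  The monomials in the z_{j,k} are
   exactly the functions mu |-> prod_j p_j^(sum_i la^j_i mu^j_i), so x and y have
   equal moments against every polynomial in the z_{j,k}.  For a fixed b and N the
   polynomial
     G_N = prod_j prod_k prod_i (1 - z_{j,k} / p_j^(b^j_0 + ... + b^j_{k-1} + i)),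
   with b^j_k < i <= b^j_{k-1} and the convention b^j_{-1} = b^j_0 + N, is bounded
   below at b uniformly in N, and vanishes at mu unless each mu^j is
   lexicographically at most b^j or some mu^j_0 exceeds b^j_0 + N.  In the second
   case the k = 0 factors are dominated by a single monomial of degree N in
   z_{j,0}, whose moments are O(2^-N) by the growth bound on C.  The first case
   leaves finitely many mu, and induction on b together with N -> oo yields
   x_b = y_b. *)

(** * Moments of non-negative weights, and signed functions with equal moments *)

Section Moments.
Set Implicit Arguments.
Unset Strict Implicit.
Variables (R : realType) (T : choiceType).
Implicit Types (x y A B G h : T -> R).

Definition moment x h : \bar R := \esum_(t in [set: T]) (x t * h t)%:E.

Lemma moment_ge0 x h :
  (forall t, 0 <= x t) -> (forall t, 0 <= h t) -> (0 <= moment x h)%E.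
Proof. by move=> x0 h0; apply: esum_ge0 => t _; rewrite lee_fin mulr_ge0. Qed.

Lemma eq_moment x h1 h2 : h1 =1 h2 -> moment x h1 = moment x h2.
Proof. by move=> eqh; apply: eq_esum => t _; rewrite eqh. Qed.

Lemma momentD x h1 h2 : (forall t, 0 <= x t) ->
  (forall t, 0 <= h1 t) -> (forall t, 0 <= h2 t) ->
  moment x (fun t => h1 t + h2 t) = (moment x h1 + moment x h2)%E.
Proof.
move=> x0 h10 h20; rewrite /moment -esumD.
- by apply: eq_esum => t _; rewrite mulrDr EFinD.
- by move=> t _; rewrite lee_fin mulr_ge0.
- by move=> t _; rewrite lee_fin mulr_ge0.
Qed.

Lemma moment_sum x (I : choiceType) (r : seq I) (P : pred I) (h : I -> T -> R) :
  (forall t, 0 <= x t) -> (forall i t, 0 <= h i t) ->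
  moment x (fun t => \sum_(i <- r | P i) h i t)
  = (\sum_(i <- r | P i) moment x (h i))%E.
Proof.
move=> x0 h0; rewrite /moment -esum_sum.
  by apply: eq_esum => t _; rewrite mulr_sumr sumEFin.
by move=> t i _ _; rewrite lee_fin mulr_ge0.
Qed.

Lemma le_momentZ x c h : (forall t, 0 <= x t) -> (forall t, 0 <= h t) ->
  0 <= c -> (moment x (fun t => c * h t)%R <= c%:E * moment x h)%E.
Proof.
move=> x0 h0 c0; apply: ge_ereal_sup => _ [X [finX _]] <-.
rewrite (eq_fsbigr (fun t => c%:E * (x t * h t)%:E)%E); last first.
  by move=> t _; rewrite -EFinM mulrCA.
rewrite -ge0_mule_fsumr; last by move=> t; rewrite lee_fin mulr_ge0.
by apply: lee_wpmul2l; [rewrite lee_fin | apply: ereal_sup_ubound; exists X].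
Qed.

Lemma momentZ x c h : (forall t, 0 <= x t) -> (forall t, 0 <= h t) ->
  0 <= c -> moment x (fun t => c * h t)%R = (c%:E * moment x h)%E.
Proof.
move=> x0 h0 c0; apply/eqP; rewrite eq_le le_momentZ//=.
have [<-|c0'] := eqVneq 0 c; last have {}c0 : 0 < c by rewrite lt_neqAle c0'.
  by rewrite mul0e moment_ge0// => t; rewrite mul0r.
have cV0 : 0 <= c^-1 by rewrite invr_ge0 ltW.
(* Reverse inequality: [le_momentZ] for the factor [c^-1], applied to [c * h]. *)
have := @le_momentZ x c^-1 (fun t => c * h t) x0.
move=> /(_ (fun t => mulr_ge0 (ltW c0) (h0 t)) cV0).
rewrite (@eq_moment _ _ h); last by move=> t; rewrite mulKf ?gt_eqF.
by move=> le_h; rewrite -lee_pdivlMl.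
Qed.

Definition equal_moments x y A :=
  [/\ forall t, 0 <= A t, moment x A = moment y A & moment x A \is a fin_num].

(** [\esum] is a supremum of finite sums, hence a sum only for non-negative terms. A signed [G] is
    therefore carried as a difference of non-negative functions with equal finite moments, and no
    moment of [G] itself is formed. *)
Definition equal_signed_moments x y G :=
  exists A B, [/\ equal_moments x y A, equal_moments x y B
    & forall t, G t = A t - B t].

Lemma equal_signed_momentsB x y c G1 G2 : (forall t, 0 <= x t) -> 
  (forall t, 0 <= y t) -> 0 <= c ->
  equal_signed_moments x y G1 -> equal_signed_moments x y G2 ->
  equal_signed_moments x y (fun t => G1 t - c * G2 t).
Proof.
have eqm A B : (forall t, 0 <= x t) -> (forall t, 0 <= y t) -> 0 <= c ->
    equal_moments x y A -> equal_moments x y B ->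
    equal_moments x y (fun t => A t + c * B t).
  move=> x0 y0 c0 [A0 eA fA] [B0 eB fB].
  have cB0 t : 0 <= c * B t by rewrite mulr_ge0.
  split; first by move=> t; rewrite addr_ge0.
    by rewrite !momentD// !momentZ// eA eB.
  by rewrite momentD// momentZ// fin_numD fA fin_numM.
move=> x0 y0 c0 [A1 [B1 [A1e B1e G1e]]] [A2 [B2 [A2e B2e G2e]]].
(* The minus sign exchanges the roles of [A2] and [B2]. *)
exists (fun t => A1 t + c * B2 t), (fun t => B1 t + c * A2 t).
split; [exact: eqm | exact: eqm | move=> t; rewrite G1e G2e; ring].
Qed.

(* Summing the pointwise inequality
   [y A + x B + (x b - y b) G b 1_b <= x A + y B + (x + y) D] over [T],
   where [G = A - B], isolates the point [b]. *)
Lemma moment_separation x y G D (b : T) (v : R) :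
  (forall t, 0 <= x t) -> (forall t, 0 <= y t) -> y b <= x b -> 0 <= G b ->
  equal_signed_moments x y G ->
  (forall t, 0 <= D t) ->
  (forall t, t != b -> x t = y t \/ `|G t| <= D t) ->
  (moment x D <= v%:E)%E -> (moment y D <= v%:E)%E ->
  (x b - y b) * G b <= v + v.
Proof.
move=> x0 y0 yx Gb0 [A [B [[A0 eA fA] [B0 eB fB] Ge]]] D0 sep xD yD.
pose d := (x b - y b) * G b.
have d0 : 0 <= d by rewrite mulr_ge0// subr_ge0.
pose e t := if t == b then d%:E else 0%E.
have sume : \esum_(t in [set: T]) e t = d%:E.
  rewrite -[RHS](@esum_set1 _ _ b (fun=> d%:E))// [RHS]esum_mkcond.
  apply: eq_esum => t _; rewrite /e (_ : (t \in [set b]) = (t == b))//.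
  by apply/idP/eqP => [/set_mem//|->]; rewrite inE.
have e0 t : (0 <= e t)%E by rewrite /e; case: ifP => _; rewrite ?lee_fin.
have P0 z h : (forall t, 0 <= z t) -> (forall t, 0 <= h t) ->
    forall t, [set: T] t -> (0 <= (z t * h t)%:E)%E.
  by move=> z0 h0 t _; rewrite lee_fin mulr_ge0.
have H : (moment y A + moment x B + d%:E
          <= moment x A + moment y B + (moment x D + moment y D))%E.
  rewrite -sume /moment -!esumD//;
    try by do ?[exact: P0 | move=> t _; do ?apply: adde_ge0 => //; exact: P0].
  apply: le_esum => t _; rewrite -!EFinD /e.
  have [->|tb] := eqVneq t b.
    rewrite -!EFinD lee_fin /d Ge.
    have := mulr_ge0 (x0 b) (D0 b); have := mulr_ge0 (y0 b) (D0 b); nra.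
  rewrite adde0 lee_fin.
  have xD0 := mulr_ge0 (x0 t) (D0 t); have yD0 := mulr_ge0 (y0 t) (D0 t).
  have [->|] := sep t tb; first by nra.
  rewrite Ge ler_norml => /andP[l1 l2].
  have l1x : 0 <= x t * (D t + (A t - B t)) by rewrite mulr_ge0//; lra.
  have l2y : 0 <= y t * (D t - (A t - B t)) by rewrite mulr_ge0//; lra.
  nra.
(* Equal moments make the sum of the [A] and [B] moments the same on both sides of [H]; being
   finite, it cancels. *)
have H2 : (moment x A + moment y B + d%:E
    <= moment x A + moment y B + (v%:E + v%:E))%E.
  apply: le_trans (leeD2l _ (leeD xD yD)).
  by move: H; rewrite -eA -eB.
rewrite -lee_fin EFinD -(@leeD2lE _ (moment x A + moment y B)%E)//.
by rewrite fin_numD fA -eB.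
Qed.

End Moments.

(** * Monomials in the partial-sum variables, and multiplication by linear factors *)

Section Monomials.
Set Implicit Arguments.
Unset Strict Implicit.
Variables (R : realType) (s : nat) (p m : 'I_s -> nat).
Hypothesis p_gt1 : forall j, (1 < p j)%N.
Local Notation M := (multipartition m).
Implicit Types (x y h G : M -> R) (l d : 'I_s -> nat -> nat) (mu : M).

(** The default 0 pads every partition with zeros, so monotonicity holds at all natural indices. *)
Definition part mu (j : 'I_s) (i : nat) : nat := nth 0%N (mu j) i.

Lemma part_nonincreasing mu j i : (part mu j i.+1 <= part mu j i)%N.
Proof.
rewrite /part; case: (mu j) => /= t t_sorted.
have [lt_i|/(nth_default 0%N)->//] := ltnP i.+1 (size t).
by have /(sortedP 0%N)/(_ i lt_i) := t_sorted.
Qed.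

Lemma part_eq mu nu :
  (forall j i, (i < m j)%N -> part mu j i = part nu j i) -> mu = nu.
Proof.
move=> eq_part; apply/ffunP => j; apply/val_inj/eq_from_tnth => i.
by rewrite !(tnth_nth 0%N); apply: eq_part.
Qed.

(** Exponents are functions on [nat] rather than multipartitions so that they can be added freely;
    [exponent_partition] converts them back. *)
Definition nonincreasing_exponents l := forall j i, (l j i.+1 <= l j i)%N.

Definition monomial l mu : R :=
  \prod_(j < s) (p j)%:R ^+ (\sum_(i < m j) l j i * part mu j i)%N.

Definition moment_bound (F : R) l : R :=
  \prod_(j < s) (F ^+ m j * (p j)%:R ^+ (\sum_(i < m j) 'C(l j i, 2))%N).

Definition exponents_add l d := fun j i => (l j i + d j i)%N.

Lemma exponents_addA l d e :
  exponents_add l (exponents_add d e) = exponents_add (exponents_add l d) e.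
Proof. by apply/funext => j; apply/funext => i; rewrite /exponents_add addnA. Qed.

Lemma nonincreasing_add l d : nonincreasing_exponents l ->
  nonincreasing_exponents d -> nonincreasing_exponents (exponents_add l d).
Proof. by move=> l_dec d_dec j i; rewrite leq_add. Qed.

(** The exponents of z_{j,k}. The indicator of a single index k > 0 would not be nonincreasing,
    which is why partial sums, not single parts, serve as variables. *)
Definition initial_segment (j : 'I_s) (k : nat) : 'I_s -> nat -> nat :=
  fun j' i => ((j' == j) && (i <= k)%N : nat).

Lemma nonincreasing_initial_segment j k :
  nonincreasing_exponents (initial_segment j k).
Proof.
move=> j' i; rewrite /initial_segment; case: eqP => //= _.
by case: leqP => // lt_ik; rewrite (ltnW lt_ik).
Qed.

Definition partial_sum mu j k := (\sum_(0 <= i < k.+1) part mu j i)%N.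

Lemma monomialD l d mu :
  monomial (exponents_add l d) mu = monomial l mu * monomial d mu.
Proof.
rewrite -big_split; apply: eq_bigr => j _ /=; rewrite -exprD -big_split.
by congr (_ ^+ _); apply: eq_bigr => i _; rewrite mulnDl.
Qed.

Lemma monomial_gt0 l mu : 0 < monomial l mu.
Proof. by apply: prodr_gt0 => j _; rewrite exprn_gt0// ltr0n ltnW. Qed.

Lemma monomial_initial_segment j k mu : (k < m j)%N ->
  monomial (initial_segment j k) mu = (p j)%:R ^+ partial_sum mu j k.
Proof.
move=> lt_km; rewrite /monomial (bigD1 j)//= [X in _ * X]big1 => [|j' /negPf ne_j'].
  rewrite mulr1 /partial_sum; congr (_ ^+ _).
  rewrite -(big_mkord xpredT
    (fun i => initial_segment j k j i * part mu j i)%N).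
  rewrite (@big_cat_nat _ _ _ k.+1)//=.
  rewrite [X in (_ + X)%N]big_nat [X in (_ + X)%N]big1 => [|i].
    rewrite addn0; apply: eq_big_nat => i; rewrite ltnS => le_ik.
    by rewrite /initial_segment eqxx le_ik mul1n.
  by case/andP => lt_ki _; rewrite /initial_segment leqNgt lt_ki andbF.
by rewrite big1// => i _; rewrite /initial_segment ne_j'.
Qed.

Lemma le_moment_bound F l d : 0 < F ->
  moment_bound F l <= moment_bound F (exponents_add l d).
Proof.
move=> F0; apply: ler_prod => j _.
have pj1 : (1 : R) <= (p j)%:R by rewrite ler1n ltnW.
apply/andP; split; first by rewrite mulr_ge0// exprn_ge0// ltW.
rewrite ler_pM2l ?exprn_gt0// ler_weXn2l//.
by apply: leq_sum => i _; apply: leq_bin2l; rewrite leq_addr.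
Qed.

(** Quantifying over [G] and over all [l] makes the property closed under products: multiplying by
    z_{j,k} only shifts [l]. *)
Definition signed_multiplier x y h := forall G,
  (forall l, nonincreasing_exponents l ->
     equal_signed_moments x y (fun t => G t * monomial l t)) ->
  forall l, nonincreasing_exponents l ->
     equal_signed_moments x y (fun t => h t * G t * monomial l t).

Lemma signed_multiplier_prod x y (I : Type) (r : seq I) (h : I -> M -> R) :
  (forall i, signed_multiplier x y (h i)) ->
  signed_multiplier x y (fun t => \prod_(i <- r) h i t).
Proof.
move=> hP; elim: r => [|i r IHr] G GP l l_dec.
  by under eq_fun do rewrite big_nil mul1r; apply: GP.
under eq_fun do rewrite big_cons -(mulrA (h i _)).
by apply: hP => // l'; exact: IHr.
Qed.

Lemma signed_multiplier_linear x y j k (c : R) :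
  (forall t, 0 <= x t) -> (forall t, 0 <= y t) -> 0 <= c -> (k < m j)%N ->
  signed_multiplier x y (fun t => 1 - c * (p j)%:R ^+ partial_sum t j k).
Proof.
move=> x0 y0 c0 km G GP l l_dec.
have -> : (fun t => (1 - c * (p j)%:R ^+ partial_sum t j k) * G t * monomial l t)
  = (fun t => G t * monomial l t
       - c * (G t * monomial (exponents_add l (initial_segment j k)) t)).
  by apply/funext => t; rewrite monomialD monomial_initial_segment//; ring.
apply: equal_signed_momentsB => //; apply: GP => //.
exact: nonincreasing_add (nonincreasing_initial_segment _ _).
Qed.

(** Quantitative analogue of [signed_multiplier]: [d] records the shift of exponents in the growth
    bound, and the constant [a] is uniform in [G], [e], [v] and [l]. *)
Definition bounded_multiplier x (F : R) h d :=
  (forall t, 0 <= h t) /\ exists2 a : R, 0 <= a & forall G e (v : R),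
  (forall t, 0 <= G t) -> 0 <= v ->
  (forall l, nonincreasing_exponents l ->
     (moment x (fun t => G t * monomial l t)%R
       <= (v * moment_bound F (exponents_add l e))%:E)%E) ->
  forall l, nonincreasing_exponents l ->
     (moment x (fun t => h t * G t * monomial l t)%R
       <= (a * v * moment_bound F (exponents_add l (exponents_add e d)))%:E)%E.

Lemma bounded_multiplier_prod x F (I : Type) (r : seq I) (h : I -> M -> R)
    (d : I -> 'I_s -> nat -> nat) :
  (forall i, bounded_multiplier x F (h i) (d i)) ->
  bounded_multiplier x F (fun t => \prod_(i <- r) h i t)
    (fun j k => \sum_(i <- r) d i j k)%N.
Proof.
move=> hP; split; first by move=> t; apply: prodr_ge0 => i _; case: (hP i).
elim: r => [|i r [a a0 IHr]].
  exists 1 => // G e v G0 v0 GP l l_dec; under eq_fun do rewrite big_nil mul1r.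
  rewrite mul1r (_ : exponents_add e _ = e); first exact: GP.
  apply/funext => j; apply/funext => k.
  by rewrite /exponents_add big_nil addn0.
have [hi0 [b b0 hiP]] := hP i.
exists (b * a) => [|G e v G0 v0 GP l l_dec]; first exact: mulr_ge0.
under eq_fun do rewrite big_cons -(mulrA (h i _)).
rewrite (_ : exponents_add e _ = exponents_add
    (exponents_add e (fun j k => \sum_(i <- r) d i j k)%N) (d i)); last first.
  apply/funext => j; apply/funext => k.
  by rewrite /exponents_add big_cons -addnA [X in (_ + X)%N]addnC.
rewrite -(mulrA b); apply: hiP => //.
- move=> t; rewrite mulr_ge0//.
  by apply: prodr_ge0 => i' _; case: (hP i').
- exact: mulr_ge0.
- by move=> l'; apply: IHr.
Qed.

Lemma bounded_multiplier_linear x F j k (c : R) : 0 < F ->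
  (forall t, 0 <= x t) -> 0 <= c -> (k < m j)%N ->
  bounded_multiplier x F (fun t => 1 + c * (p j)%:R ^+ partial_sum t j k)
    (initial_segment j k).
Proof.
move=> F0 x0 c0 km; split.
  by move=> t; rewrite addr_ge0// mulr_ge0// exprn_ge0.
exists (1 + c) => [|G e v G0 v0 GP l l_dec]; first by rewrite addr_ge0.
have -> : (fun t => (1 + c * (p j)%:R ^+ partial_sum t j k) * G t * monomial l t)
  = (fun t => G t * monomial l t
       + c * (G t * monomial (exponents_add l (initial_segment j k)) t)).
  by apply/funext => t; rewrite monomialD monomial_initial_segment//; ring.
have Gm0 l' t : 0 <= G t * monomial l' t by rewrite mulr_ge0// ltW// monomial_gt0.
rewrite momentD//; last by move=> t; rewrite mulr_ge0.
rewrite momentZ// -mulrA mulrDl mul1r EFinD; apply: leeD.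
  (* The unshifted term also obeys the shifted bound, by monotonicity of [moment_bound]; the two
     terms together give the constant [1 + c]. *)
  apply: (le_trans (GP _ l_dec)); rewrite lee_fin exponents_addA.
  by apply: ler_wpM2l => //; exact: le_moment_bound.
rewrite EFinM; apply: lee_wpmul2l; first by rewrite lee_fin.
have -> : exponents_add l (exponents_add e (initial_segment j k))
    = exponents_add (exponents_add l (initial_segment j k)) e.
  by apply/funext => j'; apply/funext => i; rewrite /exponents_add addnAC addnA.
by apply: GP; exact: nonincreasing_add (nonincreasing_initial_segment _ _).
Qed.

End Monomials.

(** * The test polynomial at [b]: zeros, lower bound and majorants *)

Section TestFunction.
Set Implicit Arguments.
Unset Strict Implicit.
Variables (R : realType) (s : nat) (p m : 'I_s -> nat).
Hypothesis p_gt1 : forall j, (1 < p j)%N.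
Hypothesis m_gt0 : forall j, (0 < m j)%N.
Local Notation M := (multipartition m).
Variable b : M.
Implicit Types (mu : M) (j : 'I_s) (N : nat).

Let p_ge1 j : (1 : R) <= (p j)%:R. Proof. by rewrite ler1n ltnW. Qed.
Let p_gt0 j : (0 : R) < (p j)%:R. Proof. exact: lt_le_trans (p_ge1 j). Qed.

Definition head_factor N j mu : R :=
  \prod_((part b j 0).+1 <= i < (part b j 0 + N).+1)
    (1 - ((p j)%:R ^+ i)^-1 * (p j)%:R ^+ partial_sum mu j 0).

(** Index [k] here controls part [k.+1]: if [mu] agrees with [b] up to [k], the zeros are exactly
    the values of that part above [part b j k.+1] and at most [part b j k]. *)
Definition tail_factor j mu : R :=
  \prod_(k < (m j).-1) \prod_((part b j k.+1).+1 <= i < (part b j k).+1)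
    (1 - ((p j)%:R ^+ (partial_sum b j k + i))^-1
         * (p j)%:R ^+ partial_sum mu j k.+1).

(** The triangle inequality taken factor by factor; with all signs positive, the growth bound on
    monomials applies. *)
Definition tail_majorant j mu : R :=
  \prod_(k < (m j).-1) \prod_((part b j k.+1).+1 <= i < (part b j k).+1)
    (1 + ((p j)%:R ^+ (partial_sum b j k + i))^-1
         * (p j)%:R ^+ partial_sum mu j k.+1).

Definition test_function N mu : R :=
  \prod_(j < s) (head_factor N j mu * tail_factor j mu).

Lemma partial_sum0 mu j : partial_sum mu j 0 = part mu j 0.
Proof. exact: big_nat1. Qed.

Lemma partial_sumS mu j k :
  partial_sum mu j k.+1 = (partial_sum mu j k + part mu j k.+1)%N.
Proof. by rewrite /partial_sum big_nat_recr. Qed.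

Lemma part_le_head mu j k : (part mu j k <= part mu j 0)%N.
Proof.
by elim: k => // k IHk; apply: leq_trans (part_nonincreasing _ _ _) IHk.
Qed.

Lemma ratio_le1 j a c : (c <= a)%N ->
  ((p j)%:R ^+ a)^-1 * (p j)%:R ^+ c <= 1 :> R.
Proof.
by move=> le_ca; rewrite mulrC ler_pdivrMr ?exprn_gt0// mul1r ler_weXn2l.
Qed.

Lemma ratio_lt1 j a c : (c < a)%N ->
  ((p j)%:R ^+ a)^-1 * (p j)%:R ^+ c < 1 :> R.
Proof.
move=> lt_ca; rewrite mulrC ltr_pdivrMr ?exprn_gt0// mul1r.
by rewrite ltr_eXn2l// ltr1n.
Qed.

Lemma ratio_ge1 j a c : (a <= c)%N ->
  1 <= ((p j)%:R ^+ a)^-1 * (p j)%:R ^+ c :> R.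
Proof.
by move=> le_ac; rewrite mulrC ler_pdivlMr ?exprn_gt0// mul1r ler_weXn2l.
Qed.

Lemma ratio_ge0 j a c : 0 <= ((p j)%:R ^+ a)^-1 * (p j)%:R ^+ c :> R.
Proof. by rewrite mulr_ge0 ?invr_ge0 ?exprn_ge0. Qed.

Lemma ratio_eq1 j a : ((p j)%:R ^+ a)^-1 * (p j)%:R ^+ a = 1 :> R.
Proof. by rewrite mulVf// expf_neq0// gt_eqF. Qed.

(** The product of the ratios in [head_factor] without the [1 -]: the exponent
    [N * part b j 0 + 'C(N.+1, 2)] is the sum of the indices [i]. *)
Definition head_majorant N j mu : R :=
  ((p j)%:R ^+ (N * part b j 0 + 'C(N.+1, 2)))^-1
  * (p j)%:R ^+ (N * part mu j 0).

Lemma head_majorant_ge0 N j mu : 0 <= head_majorant N j mu.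
Proof. exact: ratio_ge0. Qed.

Lemma head_majorantE N j mu :
  \prod_((part b j 0).+1 <= i < (part b j 0 + N).+1)
    (((p j)%:R ^+ i)^-1 * (p j)%:R ^+ part mu j 0) = head_majorant N j mu.
Proof.
rewrite /head_majorant; elim: N => [|N IHN].
  by rewrite addn0 big_geq// !mul0n !expr0 invr1 mulr1.
rewrite addnS big_nat_recr ?ltnS ?leq_addr//= IHN (binS N.+1) bin1.
rewrite mulSn [(N.+1 * _)%N]mulSn.
rewrite [(part b j 0 + N).+1]lock.
set B := part b j 0; set u := part mu j 0.
rewrite (_ : B + N * B + _ = N * B + 'C(N.+1, 2) + locked (B + N).+1)%N; last first.
  by rewrite -lock; lia.
by rewrite !exprD !invfM; ring.
Qed.

(** If [part mu j 0] is at most [part b j 0 + N], some factor vanishes. Otherwise every ratio r is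
    at least 1, and |1 - r| = r - 1 is at most r. *)
Lemma head_factor_le_majorant N j mu : (part b j 0 < part mu j 0)%N ->
  `|head_factor N j mu| <= head_majorant N j mu.
Proof.
move=> lt_b; rewrite -head_majorantE normr_prod /head_factor partial_sum0.
have [le_mu|gt_mu] := leqP (part mu j 0) (part b j 0 + N); last first.
  rewrite big_nat [leRHS]big_nat; apply: ler_prod => i /andP[_ i_le].
  rewrite normr_ge0 distrC ger0_norm.
    by rewrite lerBlDr lerDl ler01.
  by rewrite subr_ge0 ratio_ge1//; lia.
rewrite (bigD1_seq (part mu j 0)) ?mem_index_iota ?iota_uniq ?lt_b//=.
rewrite ratio_eq1 subrr normr0 mul0r.
by apply: prodr_ge0 => i _; exact: ratio_ge0.
Qed.

Lemma head_factor_le1 N j mu : (part mu j 0 <= part b j 0)%N ->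
  `|head_factor N j mu| <= 1.
Proof.
move=> le_b; rewrite normr_prod /head_factor partial_sum0 big_nat.
apply: prodr_ile1 => i /andP[lt_i _].
have r1 := @ratio_le1 j i (part mu j 0) ltac:(lia).
rewrite normr_ge0 ger0_norm ?subr_ge0//.
by rewrite lerBlDr lerDl ratio_ge0.
Qed.

(* [1/4 + 2^-(N+2)] rather than [1/4], so that the induction goes through. *)
Lemma head_factor_ge N j : 4^-1 + (2 ^+ N.+2)^-1 <= head_factor N.+1 j b.
Proof.
have le2 i : ((p j)%:R ^+ i)^-1 <= (2 ^+ i)^-1 :> R.
  by rewrite lef_pV2 ?posrE ?exprn_gt0// lerXn2r ?nnegrE// ler_nat.
rewrite /head_factor partial_sum0; set B := part b j 0.
have termE i : ((p j)%:R ^+ (B + i))^-1 * (p j)%:R ^+ B = ((p j)%:R ^+ i)^-1 :> R.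
  by rewrite exprD invfM mulrAC ratio_eq1 mul1r.
elim: N => [|N IHN].
  rewrite addn1 big_nat1 -[B.+1]addn1 termE expr2 invfM.
  by have := le2 1%N; rewrite !expr1; lra.
rewrite addnS big_nat_recr ?ltnS ?leq_addr//=.
have := termE N.+2; rewrite addnS => ->.
set h := \prod_(_ <= _ < _) _ in IHN *.
have e3 : (2 ^+ N.+3)^-1 = (2 ^+ N.+2)^-1 / 2 :> R by rewrite [in LHS]exprSr invfM.
have q1 : (2 ^+ N.+2)^-1 <= 4^-1 :> R.
  rewrite lef_pV2 ?posrE ?exprn_gt0// !exprS mulrA -[4]/(2 * 2)%:R natrM.
  by rewrite ler_peMr// exprn_ege1// ler1n.
have q0 : 0 < (2 ^+ N.+2)^-1 :> R by rewrite invr_gt0 exprn_gt0.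
have := le2 N.+2; rewrite e3.
set q := (2 ^+ N.+2)^-1 in q0 q1 IHN *; set r := ((p j)%:R ^+ _)^-1 => le_r.
(* (1/4 + q)(1 - q) exceeds 1/4 + q/2 by q(1/4 - q), which is non-negative. *)
apply: (@le_trans _ _ ((4^-1 + q) * (1 - q))).
  have q2 : 0 <= 4^-1 - q by rewrite subr_ge0.
  by have := mulr_ge0 (ltW q0) q2; lra.
have q4 : 0 <= 1 - q by lra.
have q5 : 0 <= 4^-1 + q by lra.
by apply: ler_pM => //; lra.
Qed.

Lemma tail_factor_le_majorant j mu : `|tail_factor j mu| <= tail_majorant j mu.
Proof.
rewrite normr_prod; apply: ler_prod => k _; rewrite normr_ge0 normr_prod /=.
apply: ler_prod => i _; rewrite normr_ge0 (le_trans (ler_normB _ _))// normr1.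
by rewrite ger0_norm// ratio_ge0.
Qed.

Lemma tail_majorant_ge0 j mu : 0 <= tail_majorant j mu.
Proof. exact: le_trans (normr_ge0 _) (tail_factor_le_majorant j mu). Qed.

(** At [b] each ratio is p_j to the power b_{k+1} - i with i > b_{k+1}, so every factor is
    positive. *)
Lemma tail_factor_gt0 j : 0 < tail_factor j b.
Proof.
apply: prodr_gt0 => k _; rewrite big_nat; apply: prodr_gt0 => i /andP[lt_i _].
by rewrite subr_gt0 ratio_lt1// partial_sumS ltn_add2l.
Qed.

(** The number with base [B.+1] digits [f 0, ..., f k], leading digit first. For digits at most [B],
    comparing weights is comparing lexicographically. *)
Fixpoint weight (B : nat) (f : nat -> nat) (k : nat) : nat :=
  if k is k'.+1 then (B.+1 * weight B f k' + f k)%N else f 0%N.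

Lemma eq_weight B (f g : nat -> nat) k :
  (forall i, (i <= k)%N -> f i = g i) -> weight B f k = weight B g k.
Proof.
elim: k => [|k IHk] eq_fg /=; first exact: eq_fg.
by rewrite eq_fg// IHk// => i le_i; apply: eq_fg; apply: leqW.
Qed.

(** At the first part where [mu] and [b] differ, [mu] cannot be larger: its part is at most the
    preceding one, shared with [b], so it would be a zero of [tail_factor]. *)
Lemma tail_factor_weight B j mu : (part b j 0 <= B)%N ->
  (part mu j 0 <= part b j 0)%N -> tail_factor j mu != 0 ->
  forall k, (k < m j)%N ->
  (weight B (part mu j) k < weight B (part b j) k)%N \/
  forall i, (i <= k)%N -> part mu j i = part b j i.
Proof.
move=> le_B le_b nz; elim=> [|k IHk] lt_k.
  move: le_b; rewrite leq_eqVlt => /orP[/eqP eq0|]; last by left.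
  by right=> i; rewrite leqn0 => /eqP->.
case: (IHk (ltnW lt_k)) => [lt_w|eq_k].
  left=> /=.
  (* A lead of one in the earlier digits is worth [B.+1], more than the next digit of [mu] can
     recover. *)
  have : (B.+1 * (weight B (part mu j) k).+1 <= B.+1 * weight B (part b j) k)%N.
    by rewrite leq_mul2l.
  have := part_le_head mu j k.+1; rewrite mulnS; lia.
have eq_sum : partial_sum mu j k = partial_sum b j k.
  by rewrite /partial_sum; apply: eq_big_nat => i /andP[_]; exact: eq_k.
have eq_w := eq_weight B eq_k.
have : (part mu j k.+1 <= part b j k.+1)%N.
  rewrite leqNgt; apply: contra nz => gt_b.
  have lt_k' : (k < (m j).-1)%N by lia.
  rewrite /tail_factor prodf_seq_eq0; apply/hasP; exists (Ordinal lt_k').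
    exact: mem_index_enum.
  rewrite /= prodf_seq_eq0; apply/hasP; exists (part mu j k.+1).
    rewrite mem_index_iota gt_b ltnS -eq_k//.
    exact: part_nonincreasing.
  by rewrite /= partial_sumS eq_sum ratio_eq1 subrr.
rewrite leq_eqVlt => /orP[/eqP eq1|lt1].
  right=> i; rewrite leq_eqVlt ltnS => /orP[/eqP->//|]; exact: eq_k.
by left; rewrite /= eq_w ltn_add2l.
Qed.

End TestFunction.

(** * Decay of the moments away from [b], and equality at [b] *)

Section TailMoments.
Set Implicit Arguments.
Unset Strict Implicit.
Variables (R : realType) (s : nat) (p m : 'I_s -> nat).
Hypothesis p_gt1 : forall j, (1 < p j)%N.
Hypothesis m_gt0 : forall j, (0 < m j)%N.
Local Notation M := (multipartition m).
Variable b : M.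
Implicit Types (mu : M) (j : 'I_s) (N : nat) (x y : M -> R) (S : {set 'I_s}).

Let p_ge1 j : (1 : R) <= (p j)%:R. Proof. by rewrite ler1n ltnW. Qed.
Let p_gt0 j : (0 : R) < (p j)%:R. Proof. exact: lt_le_trans (p_ge1 j). Qed.

(** The total exponent shift caused by multiplying by all the tail majorants; it does not depend on
    [N]. *)
Definition tail_exponents (j' : 'I_s) (i' : nat) : nat :=
  (\sum_(j < s) \sum_(k < (m j).-1)
     \sum_((part b j k.+1).+1 <= i < (part b j k).+1)
       initial_segment j k.+1 j' i')%N.

(** Level [k] has [part b j k - part b j k.+1] linear factors, each adding at most 1, and these
    counts telescope. *)
Lemma tail_exponents_le j i : (tail_exponents j i <= part b j 0)%N.
Proof.
rewrite /tail_exponents (bigD1 j)//= [X in (_ + X)%N]big1 => [|j' ne_j'].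
  rewrite addn0; apply: (@leq_trans (\sum_(k < (m j).-1) (part b j k - part b j k.+1))).
    apply: leq_sum => k _; rewrite -subSS -[leqRHS]muln1 -sum_nat_const_nat.
    by apply: leq_sum => i' _; rewrite leq_b1.
  rewrite -(big_mkord xpredT (fun k => part b j k - part b j k.+1)%N).
  suff le_n n : (\sum_(0 <= k < n) (part b j k - part b j k.+1) + part b j n
      <= part b j 0)%N by apply: leq_trans (leq_addr _ _) (le_n _).
  elim: n => [|n IHn]; first by rewrite big_geq.
  rewrite big_nat_recr//= -addnA subnK//; exact: part_nonincreasing.
by rewrite big1// => k _; rewrite big1// => i' _;
  rewrite /initial_segment eq_sym (negPf ne_j').
Qed.

Lemma bounded_multiplier_tail x (F : R) : 0 < F -> (forall t, 0 <= x t) ->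
  bounded_multiplier p x F (fun t => \prod_(j < s) tail_majorant R p b j t)
    tail_exponents.
Proof.
move=> F0 x0; do 3![apply: bounded_multiplier_prod => ?].
apply: bounded_multiplier_linear => //.
by rewrite -ltn_predRL; exact: ltn_ord.
Qed.

Lemma signed_multiplier_test x y N : (forall t, 0 <= x t) -> (forall t, 0 <= y t) ->
  signed_multiplier p x y (test_function R p b N).
Proof.
move=> x0 y0; apply: signed_multiplier_prod => j.
move=> G GP l l_dec; under eq_fun do rewrite -(mulrA (head_factor _ _ _ _ _ _)).
have mul_head : signed_multiplier p x y (head_factor R p b N j).
  by apply: signed_multiplier_prod => i; apply: signed_multiplier_linear.
have mul_tail : signed_multiplier p x y (tail_factor R p b j).
  do 2![apply: signed_multiplier_prod => ?].
  apply: signed_multiplier_linear => //.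
  by rewrite -ltn_predRL; exact: ltn_ord.
by apply: mul_head => // l'; exact: mul_tail.
Qed.

Definition head_exponents N (S : {set 'I_s}) (j : 'I_s) (i : nat) : nat :=
  if (j \in S) && (i == 0%N) then N else 0%N.

Lemma nonincreasing_head_exponents N S :
  nonincreasing_exponents (head_exponents N S).
Proof. by move=> j i; rewrite /head_exponents andbF. Qed.

Definition head_normalization N (S : {set 'I_s}) : R := \prod_(j < s)
  (if j \in S then ((p j)%:R ^+ (N * part b j 0 + 'C(N.+1, 2)))^-1 else 1).

Lemma head_normalization_ge0 N S : 0 <= head_normalization N S.
Proof. by apply: prodr_ge0 => j _; case: ifP; rewrite // invr_ge0 exprn_ge0. Qed.

Lemma head_majorant_prodE N S mu :
  \prod_(j in S) head_majorant R p b N j mu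
  = head_normalization N S * monomial R p (head_exponents N S) mu.
Proof.
rewrite big_mkcond -big_split; apply: eq_bigr => j _ /=.
have -> : (\sum_(i < m j) head_exponents N S j i * part mu j i
           = head_exponents N S j 0 * part mu j 0)%N.
  rewrite -(big_mkord xpredT (fun i => head_exponents N S j i * part mu j i)%N).
  rewrite -[X in index_iota 0 X](prednK (m_gt0 j)) big_nat_recl// big1 ?addn0//.
  by move=> i _; rewrite /head_exponents andbF.
rewrite /head_exponents eqxx andbT /head_majorant.
by case: ifP => // _; rewrite mul0n expr0 mulr1.
Qed.

(** For j in [S], write B for [part b j 0]. Since C(N + B, 2) = C(N, 2) + C(B, 2) + N B and C(N + 1,
    2) = C(N, 2) + N, the normalization cancels the quadratic growth in N and leaves p_j^(-N). *)
Lemma moment_bound_head_tail F N S : 0 < F -> S != finset.set0 ->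
  head_normalization N S
    * moment_bound p m F (exponents_add (head_exponents N S) tail_exponents)
  <= (\prod_(j < s) (F ^+ m j * (p j)%:R ^+ (m j * 'C(part b j 0, 2)))) * (2 ^+ N)^-1.
Proof.
move=> F0 /finset.set0Pn[j0 j0S].
apply: (@le_trans _ _ ((\prod_(j < s) (F ^+ m j * (p j)%:R ^+ (m j * 'C(part b j 0, 2))))
    * \prod_(j < s) (if j \in S then (2 ^+ N)^-1 else 1))); last first.
  apply: ler_wpM2l.
    by apply: prodr_ge0 => j _; rewrite mulr_ge0// exprn_ge0// ltW.
  (* Only the gain from [j0] is kept; the other factors are at most 1. *)
  rewrite (bigD1 j0)//= j0S ler_piMr ?invr_ge0 ?exprn_ge0//.
  apply: prodr_ile1 => j _; case: ifP => _; rewrite ?ler01 ?lexx//.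
  by rewrite invr_ge0 exprn_ge0//= invf_le1 ?exprn_gt0// exprn_ege1// ler1n.
rewrite -!big_split; apply: ler_prod => j _ /=.
set E := (\sum_(i < m j) _)%N; set Bj := part b j 0.
(* The head exponent [N] enters only at index 0; each remaining index contributes at most
   ['C(Bj, 2)]. *)
have E_le : (E <= 'C(head_exponents N S j 0 + Bj, 2) + (m j).-1 * 'C(Bj, 2))%N.
  rewrite /E -(big_mkord xpredT
    (fun i => 'C(exponents_add (head_exponents N S) tail_exponents j i, 2))).
  rewrite -[in X in (X <= _)%N](prednK (m_gt0 j)) big_nat_recl//; apply: leq_add.
    by apply: leq_bin2l; rewrite leq_add2l tail_exponents_le.
  rewrite -[X in (_ <= X * _)%N]subn0 -sum_nat_const_nat; apply: leq_sum => i _.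
  by apply: leq_bin2l; rewrite /exponents_add /head_exponents andbF tail_exponents_le.
have mE : (m j * 'C(Bj, 2) = 'C(Bj, 2) + (m j).-1 * 'C(Bj, 2))%N.
  by rewrite -[in LHS](prednK (m_gt0 j)) mulSn.
rewrite mulr_ge0/=; last first.
- by rewrite mulr_ge0// exprn_ge0// ltW.
- by case: ifP; rewrite // invr_ge0 exprn_ge0.
move: E_le; rewrite /head_exponents eqxx andbT; case: ifP => _ E_le; last first.
  rewrite mul1r mulr1 ler_pM2l ?exprn_gt0// ler_weXn2l// mE.
  by rewrite add0n in E_le.
rewrite mulrCA -mulrA ler_pM2l ?exprn_gt0//.
have binD : ('C(N + Bj, 2) = 'C(N, 2) + 'C(Bj, 2) + N * Bj)%N.
  by elim: (N) => [|n IHn]; rewrite ?add0n ?addn0// addSn !binS !bin1 IHn mulSn; lia.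
apply: (@le_trans _ _ ((p j)%:R ^+ (m j * 'C(Bj, 2)) * ((p j)%:R ^+ N)^-1)); last first.
  apply: ler_wpM2l; first by rewrite exprn_ge0.
  by rewrite lef_pV2 ?posrE ?exprn_gt0// lerXn2r ?nnegrE// ler_nat.
rewrite mulrC ler_pdivrMr ?exprn_gt0// mulrAC ler_pdivlMr ?exprn_gt0//.
rewrite -!exprD ler_weXn2l// mE binS bin1; lia.
Qed.

Lemma moment_domination x (F : R) : 0 < F -> (forall t, 0 <= x t) ->
  (forall l, nonincreasing_exponents l ->
     (moment x (monomial R p l) <= (moment_bound p m F l)%:E)%E) ->
  exists2 K : R, 0 <= K & forall N,
    (moment x (fun t => \sum_(S : {set 'I_s} | S != finset.set0)
        ((\prod_(j in S) head_majorant R p b N j t)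
         * \prod_(j < s) tail_majorant R p b j t))%R
      <= (K * (2 ^+ N)^-1)%:E)%E.
Proof.
move=> F0 x0 xP; have [Q0 [a a0 aP]] := bounded_multiplier_tail F0 x0.
pose C := \prod_(j < s) (F ^+ m j * (p j)%:R ^+ (m j * 'C(part b j 0, 2))) : R.
have C0 : 0 <= C by apply: prodr_ge0 => j _; rewrite mulr_ge0// exprn_ge0// ltW.
(* Neither [a] nor [C] depends on [N] or [S], so this constant serves every [N]. *)
exists (\sum_(S : {set 'I_s} | S != finset.set0) a * C) => [|N].
  by apply: sumr_ge0 => S _; rewrite mulr_ge0.
have hm0 j t : 0 <= head_majorant R p b N j t by exact: head_majorant_ge0.
rewrite moment_sum//; last first.
  by move=> S t; rewrite mulr_ge0//; apply: prodr_ge0 => j _.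
rewrite mulr_suml -sumEFin; apply: lee_sum => S Sn0.
pose l := head_exponents N S.
rewrite (@eq_moment _ _ _ _ (fun t => head_normalization N S
   * ((\prod_(j < s) tail_majorant R p b j t) * 1 * monomial R p l t))); last first.
  by move=> t; rewrite head_majorant_prodE; ring.
have c0 := head_normalization_ge0 N S.
rewrite momentZ//; last first.
  by move=> t; rewrite mulr1 mulr_ge0// ltW// monomial_gt0.
have := aP (fun=> 1) (fun _ _ => 0%N) 1 (fun _ => ler01) ler01.
move=> /(_ _ l (nonincreasing_head_exponents N S)) H.
apply: (@le_trans _ _ ((head_normalization N S)%:E
    * (a * 1 * moment_bound p m F (exponents_add l tail_exponents))%:E)%E).
  apply: lee_wpmul2l; first by rewrite lee_fin.
  apply: H => l' l'_dec; under eq_fun do rewrite mul1r.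
  rewrite mul1r (_ : exponents_add l' _ = l'); first exact: xP.
  by apply/funext => j; apply/funext => i; rewrite /exponents_add addn0.
rewrite -EFinM lee_fin mulr1 mulrCA -mulrA; apply: ler_wpM2l => //.
exact: moment_bound_head_tail.
Qed.

(** The term for the set [S] of those j whose first part exceeds that of [b] suffices. Summing over
    all nonempty sets gives a majorant whose form does not depend on [mu]. *)
Lemma test_function_le_domination N mu :
  (exists j, (part b j 0 < part mu j 0)%N) ->
  `|test_function R p b N mu| <= \sum_(S : {set 'I_s} | S != finset.set0)
        ((\prod_(j in S) head_majorant R p b N j mu)
         * \prod_(j < s) tail_majorant R p b j mu).
Proof.
move=> [j0 lt_j0]; pose S := [set j | (part b j 0 < part mu j 0)%N]%SET.
have S0 : S != finset.set0 by apply/finset.set0Pn; exists j0; rewrite inE.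
rewrite (bigD1 S)//= ler_wpDr//.
  apply: sumr_ge0 => S' _; rewrite mulr_ge0//; apply: prodr_ge0 => j _.
    exact: head_majorant_ge0.
  exact: tail_majorant_ge0.
rewrite [X in X * _]big_mkcond -big_split normr_prod; apply: ler_prod => j _.
rewrite normr_ge0 normrM /= ler_pM ?tail_factor_le_majorant//.
case: ifPn; rewrite inE; first exact: head_factor_le_majorant.
by rewrite -leqNgt; exact: head_factor_le1.
Qed.

Lemma test_function_ge N :
  \prod_(j < s) (4^-1 * tail_factor R p b j b) <= test_function R p b N.+1 b.
Proof.
apply: ler_prod => j _; have t0 := tail_factor_gt0 R p_gt1 b j.
rewrite mulr_ge0 ?(ltW t0)//= ler_pM2r//.
apply: le_trans (head_factor_ge R p_gt1 b N j).
by rewrite lerDl invr_ge0 exprn_ge0.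
Qed.

(** The inductive step at [b]: the separation hypothesis supplies equality at every other point
    where neither the test function vanishes through its tail nor the majorant takes over. *)
Lemma eq_at_of_moments x y (F : R) : 0 < F ->
  (forall t, 0 <= x t) -> (forall t, 0 <= y t) ->
  (forall l, nonincreasing_exponents l ->
     (moment x (monomial R p l) <= (moment_bound p m F l)%:E)%E) ->
  (forall l, nonincreasing_exponents l ->
     moment x (monomial R p l) = moment y (monomial R p l)) ->
  (forall mu, mu != b -> (forall j, (part mu j 0 <= part b j 0)%N) ->
     (forall j, tail_factor R p b j mu != 0) -> x mu = y mu) ->
  y b <= x b -> x b = y b.
Proof.
move=> F0 x0 y0 xP xy sep yx.
have yP l : nonincreasing_exponents l ->
    (moment y (monomial R p l) <= (moment_bound p m F l)%:E)%E.
  by move=> l_dec; rewrite -xy//; exact: xP.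
have [K K0 KP] := moment_domination F0 x0 xP.
have [L L0 LP] := moment_domination F0 y0 yP.
pose g := \prod_(j < s) (4^-1 * tail_factor R p b j b).
have g0 : 0 < g.
  by apply: prodr_gt0 => j _; rewrite mulr_gt0// tail_factor_gt0.
have bound N : (x b - y b) * g <= 2 * (K + L) * (2 ^+ N.+1)^-1.
  have G0 := lt_le_trans g0 (test_function_ge N).
  apply: (@le_trans _ _ ((x b - y b) * test_function R p b N.+1 b)).
    by rewrite ler_wpM2l ?subr_ge0// test_function_ge.
  pose D t := \sum_(S : {set 'I_s} | S != finset.set0)
        ((\prod_(j in S) head_majorant R p b N.+1 j t)
         * \prod_(j < s) tail_majorant R p b j t).
  have D0 t : 0 <= D t.
    apply: sumr_ge0 => S' _; rewrite mulr_ge0//; apply: prodr_ge0 => j _.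
      exact: head_majorant_ge0.
    exact: tail_majorant_ge0.
  have q0 : 0 <= (2 ^+ N.+1)^-1 :> R by rewrite invr_ge0 exprn_ge0.
  rewrite [leRHS](_ : _ =
    (K + L) * (2 ^+ N.+1)^-1 + (K + L) * (2 ^+ N.+1)^-1); last by ring.
  apply: (moment_separation x0 y0 yx (ltW G0) _ D0).
  (* The multiplier property is used with [G = 1] and read off at zero exponents, where the monomial
     is 1. *)
  - have zero_dec : nonincreasing_exponents (fun (_ : 'I_s) (_ : nat) => 0%N) by [].
    have mon0 t : monomial R p (fun (_ : 'I_s) (_ : nat) => 0%N) t = 1 :> R.
      by apply: big1 => j _; rewrite big1// => i _; rewrite mul0n.
    have := signed_multiplier_test N.+1 x0 y0 (G := fun=> 1).
    move=> /(_ _ _ zero_dec); under eq_fun do rewrite mon0 !mulr1; apply=> l l_dec.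
    under eq_fun do rewrite mul1r.
    exists (monomial R p l), (fun=> 0).
    have m0 z : moment z (fun=> 0) = 0%E :> \bar R.
      by apply: esum1 => t _; rewrite mulr0.
    split=> [||t]; last by rewrite subr0.
      split=> [t||]; [by rewrite ltW// monomial_gt0 | exact: xy |].
      rewrite ge0_fin_numE; first exact: le_lt_trans (xP _ l_dec) (ltry _).
      by apply: moment_ge0 => // t; rewrite ltW// monomial_gt0.
    by split=> //; rewrite ?m0.
  - move=> mu ne_b.
    have [/existsP lt_b|] := boolP [exists j, (part b j 0 < part mu j 0)%N].
      by right; exact: test_function_le_domination.
    rewrite negb_exists => /forallP le_b.
    have [/existsP[j /eqP tj0]|] := boolP [exists j, tail_factor R p b j mu == 0].
      right; rewrite /test_function (bigD1 j)//= tj0 mulr0 mul0r normr0.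
      exact: D0.
    rewrite negb_exists => /forallP nz; left; apply: sep => // j.
    by rewrite leqNgt.
  - by apply: le_trans (KP _) _; rewrite lee_fin ler_wpM2r// lerDl.
  - by apply: le_trans (LP _) _; rewrite lee_fin ler_wpM2r// lerDr.
apply/eqP; rewrite eq_le yx andbT leNgt; apply/negP => lt_yx.
have d0 : 0 < (x b - y b) * g by rewrite mulr_gt0// subr_gt0.
have A0 : 0 <= 2 * (K + L) / ((x b - y b) * g).
  by rewrite divr_ge0 ?(ltW d0)// mulr_ge0// addr_ge0.
(* This [n] exceeds the ratio of the constants and is below [2 ^+ n.+1], so [bound n] fails. *)
set n := Num.bound (2 * (K + L) / ((x b - y b) * g)).
have := bound n; rewrite leNgt => /negP; apply.
rewrite ltr_pdivrMr ?exprn_gt0// [ltRHS]mulrC -ltr_pdivrMr//.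
apply: lt_le_trans (archi_boundP A0) _.
by rewrite -natrX ler_nat ltnW// ltnW// ltn_expl.
Qed.

End TailMoments.

(** * From exponent functions back to multipartitions *)

Section ExponentPartition.
Set Implicit Arguments.
Unset Strict Implicit.
Variables (s : nat) (m : 'I_s -> nat) (l : 'I_s -> nat -> nat).
Hypothesis l_dec : nonincreasing_exponents l.

Lemma sorted_exponents j : sorted geq [tuple l j i | i < m j].
Proof.
apply/(sortedP 0%N) => i; rewrite size_tuple => lt_i.
have nthE k : (k < m j)%N -> nth 0%N [tuple l j i | i < m j] k = l j k.
  by move=> lt_k; rewrite -(tnth_nth _ _ (Ordinal lt_k)) tnth_mktuple.
by rewrite !nthE ?(ltnW lt_i)//; exact: l_dec.
Qed.

Definition exponent_partition : multipartition m :=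
  [ffun j => PartitionLe (sorted_exponents j)].

Lemma mpart_exponent_partition j (i : 'I_(m j)) :
  mpart exponent_partition i = l j i.
Proof. by rewrite /mpart ffunE tnth_mktuple. Qed.

End ExponentPartition.

(** * Lexicographic induction over all multipartitions *)

Theorem theorem8p2 (R : realType) (s : nat) (p m : 'I_s -> nat)
    (p_prime : forall j, prime (p j)) (p_inj : injective p)
    (m_gt0 : forall j, (1 <= m j)%N)
    (x y C : multipartition m -> R)
    (x_ge0 : forall mu, 0 <= x mu) (y_ge0 : forall mu, 0 <= y mu)
    (C_ge0 : forall la, 0 <= C la)
    (F : R) (F_gt0 : 0 < F)
    (C_le : forall la : multipartition m,
      C la <= \prod_(j < s)
        (F ^+ m j *
         (p j)%:R ^+
           (\sum_(i < m j) (mpart la i * (mpart la i - 1)) %/ 2)%N))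
    (x_moments : forall la : multipartition m,
      \esum_(mu in [set: multipartition m])
        (x mu * \prod_(j < s)
          (p j)%:R ^+ (\sum_(i < m j) mpart la i * mpart mu i)%N)%:E
      = (C la)%:E)
    (y_moments : forall la : multipartition m,
      \esum_(mu in [set: multipartition m])
        (y mu * \prod_(j < s)
          (p j)%:R ^+ (\sum_(i < m j) mpart la i * mpart mu i)%N)%:E
      = (C la)%:E) :
  forall mu : multipartition m, x mu = y mu.
Proof.
have p_gt1 j : (1 < p j)%N by exact: prime_gt1.
have monoE l (l_dec : nonincreasing_exponents l) (mu : multipartition m) :
    monomial R p l mu = \prod_(j < s) (p j)%:R ^+
      (\sum_(i < m j) mpart (exponent_partition m l_dec) i * mpart mu i)%N.
  apply: eq_bigr => j _; congr (_ ^+ _); apply: eq_bigr => i _.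
  by rewrite mpart_exponent_partition /mpart (tnth_nth 0%N).
have xE l (l_dec : nonincreasing_exponents l) :
    moment x (monomial R p l) = (C (exponent_partition m l_dec))%:E.
  by rewrite -x_moments; apply: eq_esum => mu _; rewrite monoE.
have yE l (l_dec : nonincreasing_exponents l) :
    moment y (monomial R p l) = (C (exponent_partition m l_dec))%:E.
  by rewrite -y_moments; apply: eq_esum => mu _; rewrite monoE.
have xy l : nonincreasing_exponents l ->
    moment x (monomial R p l) = moment y (monomial R p l).
  by move=> l_dec; rewrite xE yE.
have xP l : nonincreasing_exponents l ->
    (moment x (monomial R p l) <= (moment_bound p m F l)%:E)%E.
  move=> l_dec; rewrite xE lee_fin (le_trans (C_le _))// le_eqVlt; apply/orP; left.
  apply/eqP/eq_bigr => j _; congr (_ * _ ^+ _); apply: eq_bigr => i _.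
  by rewrite mpart_exponent_partition bin2 subn1 divn2.
have yP l : nonincreasing_exponents l ->
    (moment y (monomial R p l) <= (moment_bound p m F l)%:E)%E.
  by move=> l_dec; rewrite -xy//; exact: xP.
pose total_weight B (mu : multipartition m) :=
  (\sum_(j < s) weight B (part mu j) (m j).-1)%N.
(* One base [B] serves the whole induction, since every smaller [mu] that occurs has first parts
   bounded by those of [b]. *)
suff eq_xy B n b : (forall j, (part b j 0 <= B)%N) ->
    (total_weight B b < n)%N -> x b = y b.
  move=> b; apply: (eq_xy (\sum_(j < s) part b j 0)%N (total_weight _ b).+1 b) => // j.
  by rewrite (bigD1 j)//= leq_addr.
elim: n b => // n IHn b le_B lt_n.
have sep mu : mu != b -> (forall j, (part mu j 0 <= part b j 0)%N) ->
    (forall j, tail_factor R p b j mu != 0) -> x mu = y mu.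
  move=> ne_b le_b nz; apply: IHn => [j|]; first exact: leq_trans (le_b j) (le_B j).
  rewrite ltnS in lt_n; apply: leq_trans lt_n.
  have lt_m j : ((m j).-1 < m j)%N by rewrite prednK.
  have cases j := tail_factor_weight p_gt1 (le_B j) (le_b j) (nz j) (lt_m j).
  have le_w j : (weight B (part mu j) (m j).-1 <= weight B (part b j) (m j).-1)%N.
    have [/ltnW//|eq_p] := cases j.
    by rewrite (eq_weight B eq_p).
  (* No weight increases, so one strict drop lowers the total; without any drop all parts agree and
     [mu] would be [b]. *)
  have [/existsP[j lt_w]|] := boolP [exists j,
      (weight B (part mu j) (m j).-1 < weight B (part b j) (m j).-1)%N].
    rewrite /total_weight (bigD1 j)//= [in leqRHS](bigD1 j)//=.
    by rewrite -addSn leq_add// leq_sum.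
  rewrite negb_exists => /forallP nlt; case/eqP: ne_b.
  apply: part_eq => j i lt_i; have [lt_w|->//] := cases j.
    by have := nlt j; rewrite lt_w.
  by rewrite -ltnS prednK.
(* The hypotheses are symmetric in [x] and [y], so either order at [b] is covered. *)
have [yx|xy_lt] := leP (y b) (x b).
  exact: (eq_at_of_moments p_gt1 m_gt0 F_gt0 x_ge0 y_ge0 xP xy sep yx).
apply/esym; apply: (eq_at_of_moments p_gt1 m_gt0 F_gt0 y_ge0 x_ge0 yP _ _ (ltW xy_lt)).
  by move=> l l_dec; rewrite xy.
by move=> mu ne_b le_b nz; rewrite sep.
Qed.
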